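(* Let $m\geq 2$ be an integer and let $0<\theta<1$. Let $R_{x}^{m}(\xi)$ be the reproducing kernel of ${}^{0}W_{\rho}^{m}[0,1]$. Then the reproducing kernel ${}^{\theta}R_{x}^{m}(\xi)$ of ${}^{\theta}W_{\rho}^{m}[0,1]$ is $${}^{\theta}R_{x}^{m}(\xi)=R_{x}^{m}(\xi)-\frac{R_{x}^{m}(\theta)\,R_{\theta}^{m}(\xi)}{R_{\theta}^{m}(\theta)},\qquad x,\xi\in[0,1].$$
   Context: $W_{\rho}^{m}[0,1]$ is the space of real polynomials of degree at most $m$ on $[0,1]$ with inner product $\langle z,v\rangle_{W_{\rho}^{m}}=\int_{0}^{1}z(\xi)v(\xi)\,d\xi$ (weight $\rho_{[0,1]}=1$). Its subspaces ${}^{0}W_{\rho}^{m}[0,1]=\{z\in W_{\rho}^{m}[0,1]: z(0)=z(1)=0\}$ and ${}^{\theta}W_{\rho}^{m}[0,1]=\{z\in W_{\rho}^{m}[0,1]: z(0)=z(\theta)=z(1)=0\}$ carry the same inner product. The reproducing kernel of a Hilbert space $\mathbb{H}$ of real functions on $[0,1]$ is the function $(x,\xi)\mapsto R_x(\xi)$ with $R_x\in\mathbb{H}$ and $\langle \phi,R_x\rangle_{\mathbb{H}}=\phi(x)$ for all $\phi\in\mathbb{H}$, $x\in[0,1]$. The kernel of ${}^{0}W_{\rho}^{m}[0,1]$ is $R_{x}^{m}(\xi)=\sum_{j=2}^{m}h_{j}(\xi)h_{j}(x)$, where $\{h_j\}_{j=2}^m$ is the orthonormal system obtained by Gram-Schmidt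 from $\phi_j=P_j-P_0$ ($j$ even), $\phi_j=P_j-P_1$ ($j$ odd), $2\le j\le m$, with $P_j$ the shifted Legendre polynomials on $[0,1]$: $P_0=1$, $P_1(\xi)=2\xi-1$, $(n+1)P_{n+1}(\xi)=(2n+1)(2\xi-1)P_n(\xi)-nP_{n-1}(\xi)$. *)

(* Defs.v *)
From mathcomp Require Import all_boot all_order all_algebra.
From mathcomp Require Import all_classical all_reals all_analysis.

Set Implicit Arguments.
Unset Strict Implicit.
Unset Printing Implicit Defensive.

Import Order.TTheory GRing.Theory Num.Theory.

Local Open Scope classical_set_scope.
Local Open Scope ring_scope.

(* Functions on [0,1] are represented by total functions R -> R whose values
   outside [0,1] are irrelevant: every notion below only depends on the
   restrictions to [0,1]. *)

(* size p <= m.+1 means that p has degree at most m. *)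
Definition polySpace (R : realType) (m : nat) : set (R -> R) :=
  [set z | exists2 p : {poly R}, (size p <= m.+1)%N &
             {in `[0, 1], forall xi, z xi = p.[xi]}].

Definition polySpace0 (R : realType) (m : nat) : set (R -> R) :=
  [set z | [/\ polySpace m z, z 0 = 0 & z 1 = 0]].

Definition polySpaceTheta (R : realType) (m : nat) (theta : R) :
    set (R -> R) :=
  [set z | [/\ polySpace m z, z 0 = 0, z theta = 0 & z 1 = 0]].

(* The inner product for the weight rho = 1. *)
Definition innerL2 (R : realType) (z v : R -> R) : R :=
  \int[@lebesgue_measure R]_(xi in `[0, 1]) (z xi * v xi).

(* K x xi stands for R_x(xi). *)
Definition is_reproducing_kernel (R : realType) (H : set (R -> R))
    (ip : (R -> R) -> (R -> R) -> R) (K : R -> R -> R) : Prop :=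
  {in `[0, 1], forall x, H (K x) /\ forall phi, H phi -> ip phi (K x) = phi x}.

(* Main.v *)
(* The reproducing property of K theta turns evaluation at theta into an inner
   product, so the new kernel is K x minus its orthogonal projection on
   K theta. Testing a reproducing kernel against another one of the same space
   shows that they are transposes of each other; this gives symmetry, hence
   uniqueness, without using that the inner product is definite. *)
Require Import Defs.
From mathcomp Require Import all_boot all_order all_algebra.
From mathcomp Require Import all_classical all_reals all_analysis.
From mathcomp Require Import ring lra.

Set Implicit Arguments.
Unset Strict Implicit.
Unset Printing Implicit Defensive.

Import Order.TTheory GRing.Theory Num.Theory.

Local Open Scope classical_set_scope.
Local Open Scope ring_scope.

(** Side condition for the linearity of the integral: on the compact [[0, 1]] the product agrees
    with a polynomial, which is continuous. *)
Lemma polySpace_mul_integrable (R : realType) (m : nat) (z v : R -> R) :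
  polySpace m z -> polySpace m v ->
  (@lebesgue_measure R).-integrable `[0, 1]
    (EFin \o (fun xi => z xi * v xi)).
Proof.
move=> [p _ zp] [q _ vq].
have pqI : (@lebesgue_measure R).-integrable `[0, 1] (EFin \o horner (p * q)).
  apply: continuous_compact_integrable; first exact: segment_compact.
  exact/continuous_subspaceT/continuous_horner.
apply: eq_integrable pqI => // xi /[!inE] xi01 /=.
by rewrite hornerM zp ?vq.
Qed.

Lemma polySpaceDZ (R : realType) (m : nat) (z v : R -> R) (c : R) :
  polySpace m z -> polySpace m v -> polySpace m (fun xi => z xi + c * v xi).
Proof.
move=> [p sp zp] [q sq vq]; exists (p + c *: q).
  rewrite (leq_trans (size_polyD _ _))// geq_max sp/=.
  exact: leq_trans (size_scale_leq _ _) sq.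
by move=> xi xi01; rewrite hornerD hornerZ zp ?vq.
Qed.

Lemma innerL2C (R : realType) (z v : R -> R) : innerL2 z v = innerL2 v z.
Proof. by apply: eq_Rintegral => xi _; rewrite mulrC. Qed.

Lemma innerL2DZr (R : realType) (m : nat) (u z v : R -> R) (c : R) :
  polySpace m u -> polySpace m z -> polySpace m v ->
  innerL2 u (fun xi => z xi + c * v xi) = innerL2 u z + c * innerL2 u v.
Proof.
move=> Pu Pz Pv.
have uz := polySpace_mul_integrable Pu Pz.
have uv := polySpace_mul_integrable Pu Pv.
rewrite /innerL2 -RintegralZl// -RintegralD//; last first.
  exact: (integrableZl _ c uv).
by apply: eq_Rintegral => xi _; rewrite mulrDr mulrCA.
Qed.

Lemma innerL2_ge0 (R : realType) (z : R -> R) : 0 <= innerL2 z z.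
Proof. by apply: Rintegral_ge0 => xi _; rewrite -expr2 sqr_ge0. Qed.

(* The degenerate case of Cauchy-Schwarz; it replaces definiteness of the
   inner product. *)
Lemma innerL2_isotropic (R : realType) (m : nat) (z v : R -> R) :
  polySpace m z -> polySpace m v -> innerL2 z z = 0 -> innerL2 v z = 0.
Proof.
move=> Pz Pv zz0; set a := innerL2 v z; set b := innerL2 v v.
have b0 : 0 <= b := innerL2_ge0 v.
have quad t : 0 <= 2 * t * a + t ^+ 2 * b.
  pose w xi := z xi + t * v xi; have := innerL2_ge0 w.
  (* Linearity is available in the second argument only, so one copy of [w] is expanded, then the
     other after a swap. *)
  rewrite {2}/w (innerL2DZr t (polySpaceDZ t Pz Pv) Pz Pv) !(innerL2C w).
  rewrite (innerL2DZr t Pz Pz Pv) (innerL2DZr t Pv Pz Pv).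
  rewrite zz0 (innerL2C z v) -/a -/b.
  by rewrite (_ : _ + _ = 2 * t * a + t ^+ 2 * b)//; ring.
have b1 : 0 < b + 1 by lra.
(* The minimiser [- a / b] is undefined for [b = 0]; the denominator [b + 1] is always positive and
   still makes the quadratic a negative multiple of [a ^+ 2]. *)
have := quad (- a / (b + 1)).
rewrite (_ : _ + _ = - (a ^+ 2 * ((b + 2) / (b + 1) ^+ 2))); last first.
  by field; rewrite gt_eqF.
rewrite oppr_ge0 pmulr_lle0; last by rewrite divr_gt0 ?exprn_gt0//; lra.
by move=> a2; apply/eqP; rewrite -sqrf_eq0 eq_le a2 sqr_ge0.
Qed.

Lemma reproducing_kernel_transpose (R : realType) (H : set (R -> R))
    (K L : R -> R -> R) :
  is_reproducing_kernel H (@innerL2 R) K ->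
  is_reproducing_kernel H (@innerL2 R) L ->
  {in `[0, 1] &, forall x y, L x y = K y x}.
Proof.
move=> hK hL x y x01 y01; have [HK rK] := hK y y01; have [HL rL] := hL x x01.
by rewrite -(rK _ HL) -(rL _ HK) innerL2C.
Qed.

(** [K theta theta] is the squared norm of [K theta]. Were it zero, [K theta] would be orthogonal to
    the whole space, so every element would vanish at [theta]. *)
Lemma polySpace0_kernel_neq0 (R : realType) (m : nat) (K : R -> R -> R)
    (theta : R) :
  (2 <= m)%N -> 0 < theta -> theta < 1 ->
  is_reproducing_kernel (polySpace0 m) (@innerL2 R) K ->
  K theta theta != 0.
Proof.
move=> m2 t0 t1 hK.
have t01 : theta \in `[0, 1] by rewrite in_itv/= !ltW.
have [HK rK] := hK _ t01; have [PK _ _] := HK.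
(* An element of the space with no zero in the open interval; its degree 2 is where [2 <= m]
   enters. *)
have Pb : polySpace m (fun xi : R => xi * (xi - 1)).
  exists ('X * ('X - 1%:P)); last by move=> xi _; rewrite !hornerE.
  by rewrite size_Mmonic ?monicXsubC ?polyX_eq0// size_polyX size_XsubC.
have Hb : polySpace0 m (fun xi : R => xi * (xi - 1)).
  by split=> //; rewrite ?mul0r ?subrr ?mulr0.
apply/eqP => Ktt0.
have /eqP := innerL2_isotropic PK Pb (etrans (rK _ HK) Ktt0).
by rewrite (rK _ Hb) mulf_eq0 gt_eqF//= subr_eq0 lt_eqF.
Qed.

Theorem theorem3p1 (R : realType) (m : nat) (hm : (2 <= m)%N)
    (theta : R) (htheta0 : 0 < theta) (htheta1 : theta < 1)
    (K : R -> R -> R)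
    (hK : is_reproducing_kernel (polySpace0 m) (@innerL2 R) K) :
  let Ktheta := fun x xi => K x xi - K x theta * K theta xi / K theta theta in
  [/\ K theta theta != 0,
      is_reproducing_kernel (polySpaceTheta m theta) (@innerL2 R) Ktheta &
      forall L : R -> R -> R,
        is_reproducing_kernel (polySpaceTheta m theta) (@innerL2 R) L ->
        {in `[0, 1] &, forall x xi, L x xi = Ktheta x xi}].
Proof.
move=> Ktheta.
have Ktt0 := polySpace0_kernel_neq0 hm htheta0 htheta1 hK.
have t01 : theta \in `[0, 1] by rewrite in_itv/= !ltW.
have [HKt rKt] := hK _ t01; have [PKt Kt0 Kt1] := HKt.
have hKtheta : is_reproducing_kernel (polySpaceTheta m theta) (@innerL2 R)
    Ktheta.
  move=> x x01; have [HK rK] := hK x x01; have [PK K0 K1] := HK.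
  have KthetaE : Ktheta x =
      (fun xi => K x xi + (- (K x theta / K theta theta)) * K theta xi).
    by apply/funext => xi; rewrite /Ktheta mulNr mulrAC.
  split.
    split; first by rewrite KthetaE; exact: polySpaceDZ.
    - by rewrite /Ktheta K0 Kt0 mulr0 mul0r subr0.
    - by rewrite /Ktheta mulfK// subrr.
    - by rewrite /Ktheta K1 Kt1 mulr0 mul0r subr0.
  move=> phi [Pphi phi0 phit phi1].
  have Hphi : polySpace0 m phi by [].
  (* The correction term pairs with [phi] to a multiple of [phi theta], which is zero. *)
  rewrite KthetaE (innerL2DZr _ Pphi PK PKt).
  by rewrite (rK _ Hphi) (rKt _ Hphi) phit mulr0 addr0.
split=> // L hL x xi x01 xi01.
rewrite (reproducing_kernel_transpose hKtheta hL)//.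
(* Taking the same kernel twice gives the symmetry of [Ktheta], which undoes the transposition. *)
exact: (reproducing_kernel_transpose hKtheta hKtheta).
Qed.
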